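(* Let $\Omega=\mathbb T^2$, let $\alpha\in\mathbb T\setminus\mathbb Q$ (irrational, with $\alpha$ also denoting a real representative) be given, let $T:\mathbb T^2\to\mathbb T^2$ denote the associated skew-shift given by $$T(\omega_1,\omega_2)=(\omega_1+\alpha,\omega_1+\omega_2),$$ and let $\mu$ be Lebesgue measure. Then $$\mathfrak A(\Omega,T)=\mathbb Z+\alpha\mathbb Z=\{n+m\alpha:n,m\in\mathbb Z\}.$$
   Context: $\mathbb T=\mathbb R/\mathbb Z$. The skew-shift is strictly ergodic, with Lebesgue measure $\mu$ its unique invariant Borel probability measure. For a compact metric space $\Omega$, homeomorphism $T:\Omega\to\Omega$ and $T$-ergodic Borel probability measure $\mu$: the suspension is $X=(\Omega\times\mathbb R)/\!\sim$, where $(\omega,t)\sim(\omega',t')$ iff $(\omega',t')=(T^n\omega,t-n)$ for some $n\in\mathbb Z$, with classes $[\omega,t]$, flow $\overline T^{t}[\omega,s]=[\omega,s+t]$, and $\overline T$-ergodic measure $\overline\mu$ given by $\int_X g\,d\overline\mu=\int_0^1\int_\Omega g[\omega,s]\,d\mu(\omega)\,ds$. $C^\sharp(X,\mathbb T)$ is the group of homotopy classes of continuous maps $X\to\mathbb T$ (pointwise addition). For $\phi\in C(X,\mathbb T)$, $x\in X$, let $\widetilde\phi_x:\mathbb R\to\mathbb R$ be a continuous lift of $t\mapsto\phi(\overline T^{t}x)$. For $\overline\mu$-a.e. $x$, $\lim_{t\to\infty}\widetilde\phi_x(t)/t$ exists and equals a constant depending only on $[\phi]$, denoted $\mathfrak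 A_{\overline\mu}([\phi])$ (the Schwartzman homomorphism). $\mathfrak A(\Omega,T,\mu)=\mathfrak A_{\overline\mu}(C^\sharp(X,\mathbb T))\subseteq\mathbb R$ is its range; when $(\Omega,T)$ is uniquely ergodic one writes $\mathfrak A(\Omega,T)$. *)

(* Defs.v *)
From HB Require Import structures.
From mathcomp Require Import all_boot all_order all_algebra.
From mathcomp Require Import generic_quotient ring_quotient.
From mathcomp Require Import lra.
From mathcomp Require Import all_classical all_reals all_analysis.
From mathcomp Require Import measurable_realfun.

Set Implicit Arguments.
Unset Strict Implicit.
Unset Printing Implicit Defensive.

Import Order.TTheory GRing.Theory Num.Theory.
Import numFieldNormedType.Exports.

Local Open Scope classical_set_scope.
Local Open Scope ring_scope.
Local Open Scope quotient_scope.

Definition borel (Omega : ptopologicalType) :=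
  g_sigma_algebraType (@open Omega).
HB.instance Definition _ (Omega : ptopologicalType) :=
  Measurable.on (borel Omega).

Section Circle.
Context (R : realType).

Definition integers : zmodClosed R :=
  GRing.ZmodClosed.clone R Num.int_num_subdef _.

Definition circle := quotient_topology (Quotient.quot integers).

HB.instance Definition _ := Quotient.on circle.
HB.instance Definition _ := PointedTopological.on circle.
HB.instance Definition _ := GRing.isZmodule.Build circle
  (@Quotient.addqA _ integers) (@Quotient.addqC _ integers)
  (@Quotient.add0q _ integers) (@Quotient.addNq _ integers).

Definition circle_pi (x : R) : circle := \pi_circle x.

Lemma circle_pi_continuous : continuous circle_pi.
Proof. exact: pi_continuous. Qed.

Lemma circle_piB x y : circle_pi (x - y) = circle_pi x - circle_pi y.
Proof.
by rewrite /circle_pi; have := @Quotient.pi_add _ integers x (- y);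
  rewrite (@Quotient.pi_opp _ integers y).
Qed.

Lemma circle_pi_eq x y :
  circle_pi x = circle_pi y <-> exists n : int, x = y + n%:~R.
Proof.
have E : circle_pi x = circle_pi y <-> (x - y) \is a Num.int.
  have := Quotient.idealrBE integers x y.
  rewrite -[_ \in _]/(x - y \is a Num.int) => ->.
  by split=> [?|/eqP]; first exact/eqP.
split=> [/E/intrP[n xy]|[n xy]]; first by exists n; rewrite -xy addrC subrK.
by apply/E; rewrite xy addrC addKr intr_int.
Qed.

Lemma circle_piK (u : circle) : circle_pi (repr u) = u.
Proof. exact: reprK. Qed.

Lemma circle_pi_nbhs (a : R) (A : set R) :
  nbhs a A -> nbhs (circle_pi a) (circle_pi @` A).
Proof.
rewrite nbhsE => -[U [oU Ua] UA]; rewrite nbhsE.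
exists (circle_pi @` U); last exact: image_subset.
split; last by exists a.
rewrite /open/= /quotient_open.
have -> : \pi_(Quotient.quot integers) @^-1` (circle_pi @` U) =
    \bigcup_(n : int) ((fun x : R => x + n%:~R) @^-1` U).
  apply/seteqP; split=> [x [y Uy]|x [n _ Un]].
    by move=> /circle_pi_eq[n yE]; exists n => //=; rewrite -yE.
  by exists (x + n%:~R) => //; apply/circle_pi_eq; exists n.
apply: bigcup_open => n _; apply: open_comp => // x _.
by apply: cvgD; [exact: cvg_id|exact: cvg_cst].
Qed.

Lemma circle_sub_continuous :
  continuous (fun u : circle * circle => u.1 - u.2).
Proof.
move=> [u v]; rewrite -(circle_piK u) -(circle_piK v).
set a := repr u; set b := repr v; rewrite /continuous_at /= -circle_piB => W WW.
have: nbhs (a, b) ((fun p : R * R => circle_pi (p.1 - p.2)) @^-1` W).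
  have /(_ W) : circle_pi (p.1 - p.2) @[p --> (a, b)] --> circle_pi (a - b).
    apply: continuous_comp; last exact: circle_pi_continuous.
    by apply: cvgB; [exact: cvg_fst|exact: cvg_snd].
  exact.
move=> [[A B] /= [nA nB] AB].
exists (circle_pi @` A, circle_pi @` B) => /=.
  by split; exact: circle_pi_nbhs.
move=> [_ _] /= [[x Ax <-] [y By <-]].
by rewrite -circle_piB; exact: (AB (x, y)).
Qed.

HB.instance Definition _ :=
  PreTopologicalNmodule_isTopologicalZmodule.Build circle circle_sub_continuous.

End Circle.

Arguments circle_pi {R} x.

Section Homotopy.
Context (R : realType) (X : topologicalType).
Local Notation C := (continuousType X (circle R)).

Definition homotopic (f g : X -> circle R) :=
  exists H : X * R -> circle R,
    [/\ {within [set: X] `*` `[0, 1], continuous H},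
        forall x, H (x, 0) = f x & forall x, H (x, 1) = g x].

Lemma homotopic_refl (f : X -> circle R) : continuous f -> homotopic f f.
Proof.
move=> cf; exists (f \o fst); split=> //; apply: continuous_subspaceT => p.
by apply: continuous_comp; [exact: cvg_fst|exact: cf].
Qed.

Lemma homotopicB (f f' g g' : X -> circle R) : homotopic f f' ->
  homotopic g g' -> homotopic (f \- g) (f' \- g').
Proof.
move=> [H [cH H0 H1]] [K [cK K0 K1]]; exists (H \- K).
split=> [p|x|x] /=; [|by rewrite H0 K0|by rewrite H1 K1].
have HK : (fun q : subspace ([set: X] `*` `[0%R, 1%R]) => (H q, K q)) @ p -->
    (H p, K p) by exact: (cvg_pair (cH p) (cK p)).
exact: (cvg_comp _ _ HK (@sub_continuous (circle R) (H p, K p))).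
Qed.

Let zeroC : X -> circle R := cst 0.
Let oppC (f : C) : X -> circle R := fun x => - f x.
Let addC (f g : C) : X -> circle R := fun x => f x + g x.

Let zeroC_continuous : continuous zeroC.
Proof. exact: cst_continuous. Qed.

Let oppC_continuous f : continuous (oppC f).
Proof.
by move=> x; apply: continuous_comp; [exact: cts_fun|exact: opp_continuous].
Qed.

Let addC_continuous f g : continuous (addC f g).
Proof.
move=> x; have fg : (fun y => (f y, g y)) @ x --> (f x, g x).
  exact: (cvg_pair (@cts_fun _ _ f x) (@cts_fun _ _ g x)).
exact: (cvg_comp _ _ fg (@add_continuous (circle R) (f x, g x))).
Qed.

Let mkC (f : X -> circle R) (cf : continuous f) : C := mkcts cf.

Let addA : associative (fun f g : C => mkC (@addC_continuous f g)).
Proof. by move=> f g h; apply/continuousEP => x; exact: addrA. Qed.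
Let addCC : commutative (fun f g : C => mkC (@addC_continuous f g)).
Proof. by move=> f g; apply/continuousEP => x; exact: addrC. Qed.
Let add0 : left_id (mkC zeroC_continuous)
  (fun f g : C => mkC (@addC_continuous f g)).
Proof. by move=> f; apply/continuousEP => x; exact: add0r. Qed.
Let addN : left_inverse (mkC zeroC_continuous)
  (fun f : C => mkC (@oppC_continuous f))
  (fun f g : C => mkC (@addC_continuous f g)).
Proof. by move=> f; apply/continuousEP => x; exact: addNr. Qed.

HB.instance Definition _ := GRing.isZmodule.Build C addA addCC add0 addN.

Definition null_homotopic : pred C := fun f => `[< homotopic f (cst 0) >].

Lemma null_homotopic_zmod_closed : zmod_closed null_homotopic.
Proof.
split=> [|f g /asboolP f0 /asboolP g0].
  by apply/asboolP; exact: homotopic_refl.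
apply/asboolP.
have -> : (cst 0 : X -> circle R) = cst 0 \- cst 0.
  by apply/funext => x /=; rewrite subr0.
exact: (homotopicB f0 g0).
Qed.

HB.instance Definition _ :=
  GRing.isZmodClosed.Build C null_homotopic null_homotopic_zmod_closed.

(* Two maps are homotopic iff their difference is null-homotopic
   (see [Csharp_piP]), so the group of homotopy classes is the quotient of
   C(X, R/Z) by the subgroup of null-homotopic maps. *)
Definition Csharp :=
  Quotient.quot (GRing.ZmodClosed.clone C null_homotopic _).

Definition Csharp_pi (f : C) : Csharp := \pi_Csharp f.

Lemma Csharp_piP (f g : C) : Csharp_pi f = Csharp_pi g <-> homotopic f g.
Proof.
have E : (Csharp_pi f == Csharp_pi g) = (f - g \in null_homotopic).
  exact/esym/Quotient.idealrBE.
have sub0 (h : X -> circle R) : h = h \- cst 0.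
  by apply/funext => x /=; rewrite subr0.
split=> [/eqP|fg].
  rewrite E => /asboolP fg0.
  have := homotopicB fg0 (homotopicB (homotopic_refl zeroC_continuous)
    (homotopic_refl (@cts_fun _ _ g))).
  congr homotopic; apply/funext => x /=.
    by rewrite sub0r opprK; exact: subrK.
  by rewrite !sub0r opprK.
apply/eqP; rewrite E; apply/asboolP.
have := homotopicB fg (homotopic_refl (@cts_fun _ _ g)).
by congr homotopic; apply/funext => x /=; rewrite subrr.
Qed.

End Homotopy.

Section BorelProduct.
Context (R : realType).

Let I (e : rat * rat) : set R := `]ratr e.1, ratr e.2[%classic.

Lemma open_prod_rat (Omega : topologicalType) (U : set (Omega * R)) : open U ->
  exists2 V : rat * rat -> set Omega, forall e, open (V e) &
    U = \bigcup_e (V e `*` I e).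
Proof.
move=> oU; exists (fun e => interior [set w | forall t, I e t -> U (w, t)]).
  by move=> e; exact: open_interior.
have rat_nbhs (x : R) (A : set R) : nbhs x A -> exists e, I e x /\ I e `<=` A.
  rewrite -nbhs_ballE => -[_/posnumP[r] xrA].
  have /rat_in_itvoo[p] : x - r%:num < x by rewrite ltrBlDr ltrDl.
  have /rat_in_itvoo[q] : x < x + r%:num by rewrite ltrDl.
  rewrite !in_itv/= => /andP[xq qr] /andP[rp px].
  exists (p, q); split=> [|y]; rewrite /I/= in_itv/=; first by rewrite px xq.
  move=> /andP[py yq]; apply: xrA; rewrite /ball/= ltr_norml.
  by apply/andP; split; rewrite ?ltrBrDl; lra.
apply/seteqP; split=> [[w t] Uwt|[w t] [e _ [/= /interior_subset wU /wU//]]].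
have : nbhs (w, t) U by rewrite nbhsE; exists U.
move=> [[A B] /= [wA /rat_nbhs[e [et eB]]] ABU].
exists e => //; split=> //=; apply: filterS wA => v Av s es.
by apply: ABU; split=> //=; exact: eB.
Qed.

Lemma open_measurable_prod_borel (Omega : ptopologicalType)
    (U : set (Omega * R)) :
  open U -> measurable (U : set (borel Omega * R)).
Proof.
move=> /open_prod_rat[V oV ->]; apply: countable_bigcupT_measurable => // e.
apply: measurableX; last exact: measurable_itv.
by apply: sub_sigma_algebra; exact: oV.
Qed.

Lemma open_measurable_prod (U : set (R * R)) : open U -> measurable U.
Proof.
move=> /open_prod_rat[V oV ->]; apply: countable_bigcupT_measurable => // e.
apply: measurableX; last exact: measurable_itv.
exact: open_measurable.
Qed.

(* Lebesgue measure on the line, restricted to [0, 1] *)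
Definition uniform01 : probability (measurableTypeR R) R :=
  uniform_prob (@ltr01 R).

End BorelProduct.

Record homeomorphism (Omega : topologicalType) := Homeomorphism {
  homeo_fun :> Omega -> Omega;
  homeo_inv : Omega -> Omega;
  homeo_funK : cancel homeo_fun homeo_inv;
  homeo_invK : cancel homeo_inv homeo_fun;
  homeo_fun_continuous : continuous homeo_fun;
  homeo_inv_continuous : continuous homeo_inv }.

Section Suspension.
Context (R : realType) (Omega : ptopologicalType) (T : homeomorphism Omega).

Definition homeo_iter (n : int) : Omega -> Omega :=
  match n with
  | Posz k => iter k T
  | Negz k => iter k.+1 (homeo_inv T)
  end.

Lemma homeo_iterS n w : homeo_iter (n + 1) w = T (homeo_iter n w).
Proof.
case: n => [n|n]; first by rewrite -PoszD addn1.
have -> : Negz n + 1 = - n%:Z by rewrite NegzE -addn1 PoszD opprD subrK.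
case: n => [|n]; first by rewrite oppr0 /= homeo_invK.
by rewrite -[- _]/(Negz n) /= homeo_invK.
Qed.

Lemma homeo_iterD m n w :
  homeo_iter (m + n) w = homeo_iter m (homeo_iter n w).
Proof.
have P (k : nat) q u : homeo_iter (k%:Z + q) u = iter k T (homeo_iter q u).
  elim: k => [|k IH]; first by rewrite add0r.
  by rewrite -addn1 PoszD addrAC homeo_iterS IH addn1.
case: m => [k|k]; first exact: P.
have iterK j u : iter j T (iter j (homeo_inv T) u) = u.
  by elim: j u => // j IH u; rewrite iterSr iterS homeo_invK IH.
have inj j : injective (iter j T).
  by elim: j => // j IH u v /(can_inj (@homeo_funK _ T)) /IH.
by apply: (inj k.+1); rewrite [RHS]iterK -P NegzE addrA subrr add0r.
Qed.

Definition suspension_rel (p q : Omega * R) : bool :=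
  `[< exists n : int, q = (homeo_iter n p.1, p.2 - n%:~R) >].

Lemma suspension_relP p q : reflect
  (exists n : int, q = (homeo_iter n p.1, p.2 - n%:~R)) (suspension_rel p q).
Proof. exact: asboolP. Qed.

Lemma suspension_rel_equiv : equiv_class_of suspension_rel.
Proof.
have S p q : suspension_rel p q -> suspension_rel q p.
  move=> /suspension_relP[n ->]; apply/suspension_relP; exists (- n) => /=.
  by rewrite -homeo_iterD addNr mulrNz opprK subrK; case: p.
split=> [p|p q|q p r].
- by apply/suspension_relP; exists 0; rewrite subr0; case: p.
- by apply/idP/idP; exact: S.
- move=> /suspension_relP[m ->] /suspension_relP[n ->]; apply/suspension_relP.
  by exists (n + m) => /=; rewrite homeo_iterD intrD opprD addrA addrAC.
Qed.

Canonical suspension_equiv := EquivRelPack suspension_rel_equiv.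

Definition suspension := quotient_topology {eq_quot suspension_rel}.

HB.instance Definition _ := Quotient.on suspension.
HB.instance Definition _ := Topological.on suspension.
HB.instance Definition _ := isPointed.Build suspension (\pi_suspension point).

Definition suspension_pi (w : Omega) (t : R) : suspension :=
  \pi_suspension (w, t).

Lemma suspension_pi_eq w t w' t' : suspension_pi w t = suspension_pi w' t' <->
  exists n : int, w' = homeo_iter n w /\ t' = t - n%:~R.
Proof.
split=> [/eqmodP/suspension_relP[n [-> ->]]|[n [-> ->]]]; first by exists n.
by apply/eqmodP/suspension_relP; exists n.
Qed.

Definition suspension_flow (t : R) (x : suspension) : suspension :=
  suspension_pi (repr x).1 ((repr x).2 + t).

Lemma suspension_flowE t w s :
  suspension_flow t (suspension_pi w s) = suspension_pi w (s + t).
Proof.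
rewrite /suspension_flow; set p := repr _.
have : suspension_pi p.1 p.2 = suspension_pi w s.
  by rewrite /suspension_pi -surjective_pairing; exact: reprK.
move=> /suspension_pi_eq[n [-> ->]]; apply/suspension_pi_eq.
by exists n; rewrite addrAC.
Qed.

Definition suspension_proj (p : borel Omega * measurableTypeR R) :
    borel suspension :=
  suspension_pi p.1 p.2.

Lemma suspension_proj_measurable : measurable_fun setT suspension_proj.
Proof.
apply: (@measurability _ _ (borel Omega * R)%type (borel suspension) setT
  suspension_proj (@open suspension)) => //.
move=> _ [U oU <-]; rewrite setTI; apply: open_measurable_prod_borel.
rewrite (_ : _ @^-1` _ = \pi_suspension @^-1` U); first exact: oU.
by apply/seteqP; split=> -[].
Qed.

HB.instance Definition _ := isMeasurableFun.Build _ _ _ _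
  suspension_proj suspension_proj_measurable.

(* The image of mu x Lebesgue under Omega x [0, 1] -> suspension; see
   [integral_suspension_measure]. *)
Definition suspension_measure (mu : probability (borel Omega) R) :
    probability (borel suspension) R :=
  distribution (mu \x uniform01 R)%E suspension_proj.

Lemma integral_suspension_measure (mu : probability (borel Omega) R)
    (g : borel suspension -> \bar R) :
  measurable_fun setT g -> (forall x, 0 <= g x)%E ->
  (\int[suspension_measure mu]_x g x =
   \int[lebesgue_measure]_(s in `[0%R, 1%R])
     \int[mu]_w g (suspension_pi w s))%E.
Proof.
move=> mg g0; rewrite /suspension_measure ge0_integral_distribution//.
have mgp : measurable_fun setT (g \o suspension_proj).
  exact: measurableT_comp mg suspension_proj_measurable.
rewrite fubini_tonelli2//= integral_uniform//.
- by rewrite subr0 invr1 mul1e; apply: eq_integral.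
- apply: (@measurable_fun_fubini_tonelli_G _ _ (borel Omega)
    (measurableTypeR R) R mu (g \o suspension_proj)) => // p.
  exact: g0.
- by move=> s; rewrite /fubini_G; apply: integral_ge0 => w _; exact: g0.
Qed.

(* Any two continuous lifts psi of t |-> phi (flow t x) differ by an integer
   constant, so the limit does not depend on the lift. *)
Definition asymptotic_slope (phi : suspension -> circle R) (x : suspension)
    (r : R) :=
  exists psi : R -> R,
    [/\ continuous psi,
        forall t, circle_pi (psi t) = phi (suspension_flow t x) &
        psi t / t @[t --> +oo] --> r].

(* The almost sure slope, common to all the maps of the class c, is singled out
   by [get]; it is unique since suspension_measure mu is a probability. *)
Definition schwartzman (mu : probability (borel Omega) R)
    (c : Csharp R suspension) : R :=
  get [set r | forall phi : continuousType suspension (circle R),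
    Csharp_pi phi = c ->
    \forall x \ae suspension_measure mu, asymptotic_slope phi x r].

Definition schwartzman_range (mu : probability (borel Omega) R) : set R :=
  range (schwartzman mu).

End Suspension.

Section Torus.
Context (R : realType).

Definition torus := (circle R * circle R)%type.

HB.instance Definition _ := Topological.on torus.
HB.instance Definition _ := Pointed.on torus.

Definition torus_pi (p : R * R) : torus := (circle_pi p.1, circle_pi p.2).

Lemma torus_pi_continuous : continuous torus_pi.
Proof.
move=> p.
have c1 : circle_pi q.1 @[q --> p] --> (circle_pi p.1 : circle R).
  by apply: continuous_comp; [exact: cvg_fst|exact: circle_pi_continuous].
have c2 : circle_pi q.2 @[q --> p] --> (circle_pi p.2 : circle R).
  by apply: continuous_comp; [exact: cvg_snd|exact: circle_pi_continuous].
exact: (cvg_pair c1 c2).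
Qed.

Definition torus_proj (p : measurableTypeR R * measurableTypeR R) :
    borel torus :=
  torus_pi p.

Lemma torus_proj_measurable : measurable_fun setT torus_proj.
Proof.
apply: (@measurability _ _ (measurableTypeR R * measurableTypeR R)%type
  (borel torus) setT torus_proj (@open torus)) => //.
move=> _ [U oU <-]; rewrite setTI; apply: open_measurable_prod.
by apply: open_comp => // p _; exact: torus_pi_continuous.
Qed.

HB.instance Definition _ := isMeasurableFun.Build _ _ _ _
  torus_proj torus_proj_measurable.

(* The image of Lebesgue measure on [0, 1]^2 under R^2 -> (R / Z)^2 *)
Definition torus_lebesgue : probability (borel torus) R :=
  distribution (uniform01 R \x uniform01 R)%E torus_proj.

End Torus.

Section SkewShift.
Context (R : realType) (alpha : circle R).

Definition skew_shift_fun (w : torus R) : torus R :=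
  (w.1 + alpha, w.1 + w.2).

Definition skew_shift_inv (w : torus R) : torus R :=
  (w.1 - alpha, w.2 - (w.1 - alpha)).

Lemma skew_shift_funK : cancel skew_shift_fun skew_shift_inv.
Proof.
by move=> [u v]; rewrite /skew_shift_inv /= addrK addrAC subrr add0r.
Qed.

Lemma skew_shift_invK : cancel skew_shift_inv skew_shift_fun.
Proof. by move=> [u v]; rewrite /skew_shift_fun /= subrK addrC subrK. Qed.

Let cvgDc (F : torus R -> circle R) (G : torus R -> circle R) w :
  F @ w --> F w -> G @ w --> G w -> (fun z => F z + G z) @ w --> F w + G w.
Proof.
move=> cF cG.
have FG : (fun z => (F z, G z)) @ w --> (F w, G w) by exact: (cvg_pair cF cG).
exact: (cvg_comp _ _ FG (@add_continuous (circle R) (F w, G w))).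
Qed.

Let cvgBc (F : torus R -> circle R) (G : torus R -> circle R) w :
  F @ w --> F w -> G @ w --> G w -> (fun z => F z - G z) @ w --> F w - G w.
Proof.
move=> cF cG.
have FG : (fun z => (F z, G z)) @ w --> (F w, G w) by exact: (cvg_pair cF cG).
exact: (cvg_comp _ _ FG (@sub_continuous (circle R) (F w, G w))).
Qed.

Lemma skew_shift_fun_continuous : continuous skew_shift_fun.
Proof.
move=> w; have c1 : (fun z : torus R => z.1) @ w --> w.1 by exact: cvg_fst.
have c2 : (fun z : torus R => z.2) @ w --> w.2 by exact: cvg_snd.
have ca : (fun z : torus R => alpha) @ w --> alpha by exact: cvg_cst.
exact: (cvg_pair (cvgDc c1 ca) (cvgDc c1 c2)).
Qed.

Lemma skew_shift_inv_continuous : continuous skew_shift_inv.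
Proof.
move=> w; have c1 : (fun z : torus R => z.1) @ w --> w.1 by exact: cvg_fst.
have c2 : (fun z : torus R => z.2) @ w --> w.2 by exact: cvg_snd.
have ca : (fun z : torus R => alpha) @ w --> alpha by exact: cvg_cst.
exact: (cvg_pair (cvgBc c1 ca) (cvgBc c2 (cvgBc c1 ca))).
Qed.

Definition skew_shift : homeomorphism (torus R) :=
  Homeomorphism skew_shift_funK skew_shift_invK
    skew_shift_fun_continuous skew_shift_inv_continuous.

End SkewShift.

(* Main.v *)
(* On the universal cover R^3 of the suspension, a map to the circle has a real
   lift F, whose increments along the deck transformations (x + 1, y, t),
   (x, y + 1, t) and (x + alpha, x + y, t - 1) are integers a, b and c. The
   commutation relation between the first and the third forces b = 0, so
   F - a x - (a alpha - c) t is invariant under all three, hence bounded for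
   t >= 0, and the slope is a alpha - c at every point. A homotopy lifts in the
   same way with one more parameter, which cannot change the integers a and c.
   Conversely [w, t] |-> m w.1 + (n + m alpha) t has slope n + m alpha. *)
Require Import Defs.
From mathcomp Require Import all_boot all_order all_algebra.
From mathcomp Require Import ring lra zify.
From mathcomp Require Import all_classical all_reals all_analysis.

Import Order.TTheory GRing.Theory Num.Theory.
Import numFieldNormedType.Exports.

Local Open Scope classical_set_scope.
Local Open Scope ring_scope.

(** By the intermediate value theorem, distinct integers [h 0] and [h 1] would force [h] to take the
    half-integer just above the smaller one. Uniqueness of lifts and continuity of [circle_lift]
    both rest on this. *)
Lemma int_valued_continuous_const {R : realType} {h : R -> R} :
  {in `[0, 1], continuous h} -> {in `[0, 1], forall t, h t \is a Num.int} ->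
  h 0 = h 1.
Proof.
move=> ch hint.
have in0 : (0 : R) \in `[0, 1] by rewrite in_itv /= lexx ler01.
have in1 : (1 : R) \in `[0, 1] by rewrite in_itv /= lexx ler01.
have /intrP[p hp] := hint _ in0; have /intrP[q hq] := hint _ in1.
have hw : {within `[0, 1], continuous h}.
  by apply: continuous_in_subspaceT => t /set_mem; exact: ch.
have mid v : Num.min (h 0) (h 1) <= v <= Num.max (h 0) (h 1) ->
    v \is a Num.int.
  by move=> /(IVT ler01 hw)[c c01 <-]; exact: hint.
rewrite hp hq in mid *; congr (_%:~R).
have E (i j : int) : i < j -> i%:~R <= (i%:~R + 2^-1 : R) <= j%:~R.
  move=> ij; have : ((i + 1)%:~R : R) <= j%:~R by rewrite ler_int; lia.
  by rewrite intrD => ?; apply/andP; split; lra.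
have nint (i : int) : (i%:~R + 2^-1 : R) \isn't a Num.int.
  apply/negP => /intrP[k ik].
  have : (2 * i + 1)%:~R = (2 * k)%:~R :> R.
    by rewrite intrD !intrM -ik; field.
  by move=> /eqP; rewrite eqr_int => /eqP; lia.
apply/eqP/negP => /negP; rewrite neq_lt => /orP[pq|pq].
- have := mid (p%:~R + 2^-1); rewrite (negbTE (nint p)) => H.
  by apply/notF/H; rewrite /Num.min/Num.max ltr_int pq E.
- have := mid (q%:~R + 2^-1); rewrite (negbTE (nint q)) => H.
  by apply/notF/H; rewrite /Num.min/Num.max ltr_int (lt_gtF pq) E.
Qed.

(** * Lifting circle-valued maps to real-valued ones *)

Section CircleLift.
Context {R : realType}.

(* The section of circle_pi with values in [-1/2, 1/2[ *)
Definition circle_sec (u : circle R) : R :=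
  repr u - (Num.floor (repr u + 2^-1))%:~R.

Lemma circle_secK : cancel circle_sec circle_pi.
Proof.
move=> u; rewrite -[RHS](circle_piK u); apply/circle_pi_eq.
by exists (- Num.floor (repr u + 2^-1)); rewrite intrN.
Qed.

Lemma circle_piK_sec {a : R} : `|a| < 2^-1 -> circle_sec (circle_pi a) = a.
Proof.
rewrite ltr_norml => /andP[a1 a2]; rewrite /circle_sec.
have /circle_pi_eq[n ->] := circle_piK (circle_pi a).
suff -> : Num.floor (a + n%:~R + 2^-1) = n by rewrite addrK.
by apply/floor_def; rewrite intrD; apply/andP; split; lra.
Qed.

(** The complement of the class of 1/2, the only point at which [circle_sec] jumps. *)
Definition near0 : set (circle R) := circle_pi @` [set a : R | `|a| < 2^-1].

Lemma nbhs_near0 : nbhs 0 near0.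
Proof.
have -> : 0 = circle_pi 0 :> circle R.
  by rewrite -[in RHS](subrr 0) circle_piB subrr.
apply: circle_pi_nbhs; apply/nbhs_ballP; exists 2^-1 => //= a.
by rewrite /ball /= sub0r normrN.
Qed.

Lemma circle_sec_continuous {u : circle R} :
  near0 u -> {for u, continuous circle_sec}.
Proof.
move=> [a aS <-] W; rewrite /nbhs/= circle_piK_sec// => Wa.
have : nbhs a (W `&` [set b : R | `|b| < 2^-1]).
  apply: filterI => //; apply: open_nbhs_nbhs; split=> //.
  apply: (@open_comp _ _ (fun b : R => `|b|) [set c | c < 2^-1]).
    by move=> b _; exact: norm_continuous.
  exact: open_lt.
move=> /circle_pi_nbhs; apply: filterS => _ [b [Wb bS] <-].
by rewrite /= circle_piK_sec.
Qed.

(** The retraction of the line onto [0, 1]. It extends paths and homotopies to all real parameters,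
    and the absolute values make its continuity immediate. *)
Definition clamp01 (t : R) : R := (`|t| - `|t - 1| + 1) / 2.

Lemma clamp01_continuous : continuous clamp01.
Proof.
move=> t; apply: cvgM; last exact: cvg_cst.
apply: cvgD; last exact: cvg_cst.
apply: cvgB; first exact: norm_continuous.
apply: (continuous_comp (f := fun t : R => t - 1) (g := fun t : R => `|t|));
  last exact: norm_continuous.
by apply: cvgB; [exact: cvg_id|exact: cvg_cst].
Qed.

Lemma clamp01_itv t : 0 <= clamp01 t <= 1.
Proof.
by rewrite /clamp01; case: (ger0P t); case: (ger0P (t - 1)) => *;
  apply/andP; split; lra.
Qed.

Lemma clamp01_id t : 0 <= t <= 1 -> clamp01 t = t.
Proof.
move=> /andP[t0 t1]; rewrite /clamp01 (ger0_norm t0) ler0_norm ?subr_le0//.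
by field.
Qed.

Lemma circle_piD x y : circle_pi (x + y : R) = circle_pi x + circle_pi y.
Proof.
have N : circle_pi (- y) = - circle_pi y.
  by rewrite -sub0r circle_piB -[0](subrr 0) circle_piB subrr sub0r.
by rewrite -[in LHS](opprK y) circle_piB N opprK.
Qed.

Lemma circle_pi0 : circle_pi 0 = 0 :> circle R.
Proof. by rewrite -[in LHS](subrr 0) circle_piB subrr. Qed.

Lemma cvg_circleB {T : topologicalType} (f g : T -> circle R) x :
  {for x, continuous f} -> {for x, continuous g} ->
  {for x, continuous (fun y => f y - g y)}.
Proof.
move=> cf cg.
have fg : (fun z => (f z, g z)) @ x --> (f x, g x) by exact: (cvg_pair cf cg).
exact: (cvg_comp _ _ fg (@sub_continuous (circle R) (f x, g x))).
Qed.

(** Uniform continuity of [g] on [0, 1]: the difference [g y - g t] vanishes on the diagonal, so it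
    is small around each diagonal point, and compactness of [0, 1] gives one [N] for all of them. *)
Lemma uniform_near0 {g : R -> circle R} : continuous g ->
  exists N : nat, forall t y, 0 <= t <= 1 -> `|y - t| <= N.+1%:R^-1 ->
    near0 (g y - g t).
Proof.
move=> cg; have := @segment_compact R 0 1.
move=> /compact_near_coveringP /(_ nat \oo (fun n t => forall y,
  `|y - t| <= n.+1%:R^-1 -> near0 (g y - g t)) _).
case=> [t t01|N _ /(_ N (leqnn N)) H].
  have : {for (t, t), continuous (fun p : R * R => g p.1 - g p.2)}.
    by apply: cvg_circleB; apply: continuous_comp;
      [exact: cvg_fst|exact: cg|exact: cvg_snd|exact: cg].
  move=> /(_ near0); rewrite subrr => /(_ nbhs_near0) H.
  have /nbhs_ballP[e /= e0 He] :
    nbhs (t, t) [set p : R * R | near0 (g p.1 - g p.2)] by exact: H.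
  (* The radius is halved because [s] moves away from [t] and [y] then moves away from [s]. *)
  exists (ball t (e / 2), [set n : nat | n.+1%:R^-1 < e / 2 :> R]) => /=.
    split; first by apply: nbhsx_ballx; lra.
    have e20 : 0 < e / 2 by lra.
    exact: (near_infty_natSinv_lt (PosNum e20)).
  move=> [s n] /= [ts ne] y ysn; apply: (He (y, s)); split => /=.
    apply: (@ball_split _ _ s) => //=.
    by rewrite /ball/= distrC; exact: le_lt_trans ysn ne.
  by apply: (le_ball _ ts); lra.
by exists N => t y t01; apply: H; rewrite /= in_itv.
Qed.

(** The segment from 0 to [t] is cut into [N.+1] equal pieces, over each of which [g] changes by an
    element of [near0]. Adding the [circle_sec] of these changes gives a telescoping sum modulo 1.
    The cutting points scale with [t], so the sum is continuous in [t]. *)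
Lemma path_lift {g : R -> circle R} : continuous g ->
  exists l : R -> R, [/\ continuous l, l 0 = circle_sec (g 0) &
    forall t, 0 <= t <= 1 -> circle_pi (l t) = g t].
Proof.
move=> cg; have [N gN] := uniform_near0 cg.
pose p (k : nat) t := k%:R / N.+1%:R * clamp01 t.
have N0 : 0 < N.+1%:R :> R by rewrite ltr0n.
have cp k : continuous (p k).
  by move=> t; apply: cvgM; [exact: cvg_cst|exact: clamp01_continuous].
pose l t := circle_sec (g 0) +
  \sum_(k < N.+1) circle_sec (g (p k.+1 t) - g (p k t)).
have c0 : clamp01 0 = 0 by rewrite clamp01_id// lexx ler01.
have sec0 : circle_sec 0 = 0 :> R.
  by rewrite -circle_pi0 circle_piK_sec// normr0.
exists l; split.
- move=> t; apply: cvgD; first exact: cvg_cst.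
  apply: cvg_big => [|k _]; first exact: add_continuous.
  apply: (continuous_comp (f := fun t => g (p k.+1 t) - g (p k t))).
    by apply: cvg_circleB; apply: continuous_comp;
      [exact: cp|exact: cg|exact: cp|exact: cg].
  apply: circle_sec_continuous; apply: gN.
    have /andP[t0 t1] := clamp01_itv t.
    rewrite /p (mulr_ge0 (divr_ge0 _ _) t0) //=.
    apply: mulr_ile1 => //.
    by rewrite ler_pdivrMr// mul1r ler_nat ltnW.
  have /andP[t0 t1] := clamp01_itv t.
  have -> : p k.+1 t - p k t = clamp01 t / N.+1%:R.
    by rewrite /p -natr1; field; rewrite addrC natr1 gt_eqF.
  by rewrite (ger0_norm (divr_ge0 t0 _))// ler_pdivrMr// mulVf ?gt_eqF.
- rewrite /l big1 ?addr0// => k _.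
  by rewrite /p c0 !mulr0 subrr.
- move=> t t01; rewrite /l.
  have E m : circle_pi (circle_sec (g 0) +
      \sum_(k < m) circle_sec (g (p k.+1 t) - g (p k t))) = g (p m t).
    elim: m => [|m IH].
      by rewrite big_ord0 addr0 circle_secK /p !mul0r.
    by rewrite big_ord_recr /= addrA circle_piD IH circle_secK addrC subrK.
  by rewrite E /p divff ?gt_eqF// mul1r clamp01_id.
Qed.

(* F v is the endpoint of the lift of the path t |-> G (t *: v); the tube lemma
   on the compact [0, 1] makes it continuous. *)
Lemma circle_lift {V : normedModType R} {G : V -> circle R} : continuous G ->
  exists2 F : V -> R, continuous F & forall v, circle_pi (F v) = G v.
Proof.
move=> cG.
have cGt v : continuous (fun t : R => G (t *: v)).
  move=> t; apply: (continuous_comp (f := fun t : R => t *: v)); last exact: cG.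
  by apply: cvgZr_tmp; exact: cvg_id.
have /choice[l /all_and3[cl l0 lG]] := fun v => path_lift (cGt v).
have in1 : 0 <= (1 : R) <= 1 by rewrite lexx ler01.
exists (fun v => l v 1) => [v|v]; last by rewrite lG// scale1r.
have cGG (t : R) : {for (t, v), continuous
    (fun p : R * V => G (p.1 *: p.2) - G (p.1 *: v))}.
  apply: cvg_circleB.
    apply: (continuous_comp (f := fun p : R * V => p.1 *: p.2)); last exact: cG.
    by apply: cvgZ; [exact: cvg_fst|exact: cvg_snd].
  apply: (continuous_comp (f := fun p : R * V => p.1 *: v)); last exact: cG.
  by apply: cvgZr_tmp; exact: cvg_fst.
have tube : \forall w \near v, forall t, 0 <= t <= 1 ->
    near0 (G (t *: w) - G (t *: v)).
  have := @segment_compact R 0 1.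
  move=> /compact_near_coveringP /(_ V (nbhs v) (fun w t =>
    near0 (G (t *: w) - G (t *: v))) _).
  have H (t : R) : `[0, 1]%classic t -> \forall t' \near t & w \near v,
      near0 (G (t' *: w) - G (t' *: v)).
    by move=> _; apply: (cGG t); rewrite subrr; exact: nbhs_near0.
  by move=> /(_ H); apply: filterS => w Hw t t01; apply: Hw; rewrite /= in_itv.
have lE : \forall w \near v, l v 1 + circle_sec (G w - G v) = l w 1.
  apply: filterS tube => w Hw.
  (* Modulo 1 the two lifts differ by exactly the [circle_sec] term, so [h] is integer-valued, hence
     constant. It vanishes at 0, where both lifts start from [circle_sec (G 0)]. *)
  pose h t := l w t - l v t - circle_sec (G (t *: w) - G (t *: v)).
  have : h 0 = h 1.
    apply: int_valued_continuous_const => t; rewrite in_itv/= => t01.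
      apply: cvgB; first by apply: cvgB; exact: cl.
      apply: (continuous_comp (f := fun t : R => G (t *: w) - G (t *: v))).
        by apply: cvg_circleB; exact: cGt.
      exact: circle_sec_continuous (Hw t t01).
    have : circle_pi (h t) = circle_pi 0.
      by rewrite /h 2!circle_piB !lG// circle_secK subrr circle_pi0.
    by move=> /circle_pi_eq[n ->]; rewrite add0r intr_int.
  rewrite /h !scale0r !scale1r !l0 !scale0r !subrr -circle_pi0.
  by rewrite circle_piK_sec ?normr0// subr0; lra.
apply: (cvg_trans (near_eq_cvg lE)).
have {2}-> : l v 1 = l v 1 + circle_sec (G v - G v).
  by rewrite subrr -circle_pi0 circle_piK_sec ?normr0// addr0.
apply: cvgD; first exact: cvg_cst.
apply: (continuous_comp (f := fun w => G w - G v)).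
  by apply: cvg_circleB; [exact: cG|exact: cvg_cst].
apply: circle_sec_continuous; rewrite subrr; exact: nbhs_singleton nbhs_near0.
Qed.

End CircleLift.

(** * Uniqueness of lifts and of asymptotic slopes *)

Section Slope.
Context {R : realType}.

(** Along the segment from 0 to [v] the difference of the two lifts is continuous and
    integer-valued, so its value at [v] is its value at 0. *)
Lemma lift_unique {V : normedModType R} {F1 F2 : V -> R} :
  continuous F1 -> continuous F2 ->
  (forall v, circle_pi (F1 v) = circle_pi (F2 v)) ->
  exists n : int, forall v, F1 v = F2 v + n%:~R.
Proof.
move=> c1 c2 eqF.
have /intrP[n nE] : F1 0 - F2 0 \is a Num.int.
  by have /circle_pi_eq[n ->] := eqF 0; rewrite addrAC subrr add0r intr_int.
exists n => v; pose h t := F1 (t *: v) - F2 (t *: v).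
suff : h 0 = h 1 by rewrite /h scale0r scale1r nE => ->; rewrite addrC subrK.
apply: int_valued_continuous_const.
  have cv : continuous (fun t : R => t *: v).
    by move=> t; apply: cvgZr_tmp; exact: cvg_id.
  by move=> t _; apply: cvgB; apply: continuous_comp;
    [exact: cv|exact: c1|exact: cv|exact: c2].
move=> t _; rewrite /h; have /circle_pi_eq[m ->] := eqF (t *: v).
by rewrite addrAC subrr add0r intr_int.
Qed.

Lemma cvg_slope {psi : R -> R} {r C t0 : R} :
  (forall t, t0 <= t -> `|psi t - r * t| <= C) -> psi t / t @[t --> +oo] --> r.
Proof.
move=> H; apply/cvgrPdist_le => e e0.
near=> t.
have t1 : 0 < t by near: t; exact: nbhs_pinfty_gt.
(* The distance becomes [|psi t - r * t| / t], at most [C / t], which is below [e] as soon as [t]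
   exceeds [C / e]. *)
rewrite distrC -[r](mulfK (lt0r_neq0 t1)) -mulrBl normrM normfV (gtr0_norm t1).
rewrite ler_pdivrMr//.
apply: le_trans (H t _) _; first by near: t;
  apply: nbhs_pinfty_ge; exact: num_real.
by rewrite mulrC -ler_pdivrMr//; near: t;
  apply: nbhs_pinfty_ge; exact: num_real.
Unshelve. all: end_near. Qed.

(** Two lifts along an orbit differ by an integer constant, which disappears in the limit after
    division by [t]. *)
Lemma asymptotic_slope_unique {Omega : ptopologicalType}
    {T : homeomorphism Omega} {phi : suspension R T -> circle R} {x r r'} :
  asymptotic_slope phi x r -> asymptotic_slope phi x r' -> r = r'.
Proof.
move=> [p [cp pphi pr]] [q [cq qphi qr]].
have [n pq] : exists n : int, forall t, p t = q t + n%:~R.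
  by apply: lift_unique => // t; rewrite pphi qphi.
have n0 : n%:~R / t @[t --> +oo] --> (0 : R).
  apply: (cvg_slope (C := `|n%:~R|) (t0 := 0) (psi := cst n%:~R)) => t _.
  by rewrite mul0r subr0.
rewrite -[r']addr0; apply: (cvg_unique (@Rhausdorff R) pr).
rewrite /=; apply: cvg_trans (cvgD qr n0).
by apply: near_eq_cvg; apply: nearW => t; rewrite pq mulrDl.
Qed.

Lemma floor_frac (x : R) : 0 <= x - (Num.floor x)%:~R <= 1.
Proof.
have /andP[] := floor_itv x; rewrite intrD => *.
by apply/andP; split; lra.
Qed.

Lemma periodic_int {f : R -> R} : (forall x, f (x + 1) = f x) ->
  forall (n : int) x, f (x - n%:~R) = f x.
Proof.
move=> f1; have fn (n : nat) x : f (x + n%:R) = f x.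
  by elim: n => [|n IH]; rewrite ?addr0// -natr1 addrA f1.
case=> [n|n] x; first by rewrite -[x in RHS](subrK n%:R) fn.
by rewrite NegzE intrN opprK; exact: fn.
Qed.

End Slope.

(** * Slopes on the suspension of the skew-shift *)

Section SkewSlope.
Context {R : realType} {alpha : R}.
Let T := skew_shift (circle_pi alpha).
(** In a point [((x, y), (t, s))], the coordinates [x], [y], [t] describe the universal cover of the
    suspension and [s] is the homotopy parameter. *)
Let V : normedModType R := ((R * R) * (R * R))%type.

Lemma suspension_skew (x y t : R) : suspension_pi T (torus_pi (x, y)) t =
  suspension_pi T (torus_pi (x + alpha, x + y)) (t - 1).
Proof.
apply/suspension_pi_eq; exists 1; split=> //.
by rewrite /torus_pi /= !circle_piD.
Qed.

Lemma suspension_pi_continuous :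
  continuous (fun q : torus R * R => suspension_pi T q.1 q.2).
Proof.
have -> : (fun q : torus R * R => suspension_pi T q.1 q.2) =
    \pi_(suspension R T)%qT by apply/funext => -[].
exact: pi_continuous.
Qed.

(** A homotopy is continuous only relative to parameters in [0, 1]. Clamping [s] keeps every
    argument in that set, so the composite is continuous on the whole vector space, as [circle_lift]
    requires. *)
Lemma homotopy_cover_continuous {H : suspension R T * R -> circle R} :
  {within [set: suspension R T] `*` `[0, 1], continuous H} ->
  continuous (fun p : V => H (suspension_pi T (torus_pi p.1) p.2.1,
    clamp01 p.2.2)).
Proof.
move=> cH p.
pose q p : suspension R T * R :=
  (suspension_pi T (torus_pi p.1) p.2.1, clamp01 p.2.2).
have qA (u : V) : ([set: suspension R T] `*` `[0, 1]) (q u).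
  by split=> //=; rewrite in_itv /= clamp01_itv.
have c1 : (fun p : V => p.1) @ p --> p.1 by exact: cvg_fst.
have c2 : (fun p : V => p.2) @ p --> p.2 by exact: cvg_snd.
have c21 : (fun p : V => p.2.1) @ p --> p.2.1 by exact: cvg_comp c2 cvg_fst.
have c22 : (fun p : V => p.2.2) @ p --> p.2.2 by exact: cvg_comp c2 cvg_snd.
have cs : (fun p : V => suspension_pi T (torus_pi p.1) p.2.1) @ p -->
    suspension_pi T (torus_pi p.1) p.2.1.
  have ct := cvg_comp _ _ c1 (@torus_pi_continuous R p.1).
  exact: (cvg_comp _ _ (cvg_pair ct c21)
    (@suspension_pi_continuous (torus_pi p.1, p.2.1))).
have cc := cvg_comp _ _ c22 (@clamp01_continuous R p.2.2).
have cq : q @ p --> q p := cvg_pair cs cc.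
move=> W HW.
have : within ([set: suspension R T] `*` `[0, 1]) (nbhs (q p)) (H @^-1` W).
  by rewrite nbhs_subspace_in; [exact: cH|exact: qA].
move=> /cq Hq.
have {}Hq : nbhs p (fun u => ([set: suspension R T] `*` `[0, 1]) (q u) ->
    W (H (q u))) by exact: Hq.
suff: nbhs p (fun u => W (H (q u))) by [].
by apply: filterS Hq => u; apply; exact: qA.
Qed.

Lemma suspension_skew_surj (p : suspension R T) :
  exists x y t, p = suspension_pi T (torus_pi (x, y)) t.
Proof.
exists (repr (repr p).1.1), (repr (repr p).1.2), (repr p).2.
rewrite /torus_pi /= !circle_piK /suspension_pi -!surjective_pairing.
exact/esym/reprK.
Qed.

(** The three invariances bring any point with nonnegative time into the compact cube [0, 1]^4,
    where continuity gives the bound. *)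
Lemma skew_bounded {K : V -> R} : continuous K ->
  (forall x y t s, K ((x + 1, y), (t, s)) = K ((x, y), (t, s))) ->
  (forall x y t s, K ((x, y + 1), (t, s)) = K ((x, y), (t, s))) ->
  (forall x y t s, K ((x + alpha, x + y), (t - 1, s)) = K ((x, y), (t, s))) ->
  exists M, forall x y t s, 0 <= t -> 0 <= s <= 1 ->
    `|K ((x, y), (t, s))| <= M.
Proof.
move=> cK K1 K2 K3.
have cpt : compact ((`[0, 1] `*` `[0, 1]) `*` (`[0, 1] `*` `[0, 1]) : set V).
  by apply: compact_setX; apply: compact_setX; exact: segment_compact.
have [M MK] : exists M, forall x y t s, 0 <= x <= 1 -> 0 <= y <= 1 ->
    0 <= t <= 1 -> 0 <= s <= 1 -> `|K ((x, y), (t, s))| <= M.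
  have := compact_bounded (continuous_compact (continuous_subspaceT cK) cpt).
  move=> /(pinfty_ex_gt (num_real 0))[M _ MK].
  exists M => x y t s x01 y01 t01 s01.
  by apply: MK; exists ((x, y), (t, s)) => //=; rewrite !in_itv.
(* Time is lowered first, one unit per induction step, because the third invariance also moves [x]
   and [y]. Their integer parts are removed once [t] lies in [0, 1]. *)
exists M; suff H (n : nat) x y t s : 0 <= t <= n.+1%:R -> 0 <= s <= 1 ->
    `|K ((x, y), (t, s))| <= M.
  move=> x y t s t0; apply: (H (Num.trunc t)).
  by rewrite t0 /= ltW// truncnS_gt.
elim: n x y t => [|n IH] x y t t01 s01.
  rewrite -(periodic_int (fun x => K1 x y t s) (Num.floor x)).
  rewrite -(periodic_int (fun y => K2 _ y t s) (Num.floor y)).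
  by apply: MK; rewrite ?floor_frac.
have [t1|t1] := leP t 1.
  apply: IH => //; case/andP: t01 => -> _ /=.
  by apply: le_trans t1 _; rewrite ler1n.
rewrite -K3; apply: IH => //; case/andP: t01 => _; rewrite -natr1 => tn.
by apply/andP; split; lra.
Qed.

(** Treating both ends of a homotopy at once gives homotopy invariance; the constant homotopy gives
    the existence of the slope for a single map. *)
Lemma homotopic_slope {f g : suspension R T -> circle R} : homotopic f g ->
  exists a c : int, forall x,
    asymptotic_slope f x (a%:~R * alpha - c%:~R) /\
    asymptotic_slope g x (a%:~R * alpha - c%:~R).
Proof.
move=> [H [cH H0 H1]].
pose G (p : V) := H (suspension_pi T (torus_pi p.1) p.2.1, clamp01 p.2.2).
have [F cF FG] : exists2 F : V -> R, continuous F &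
    forall p, circle_pi (F p) = G p.
  exact: circle_lift (homotopy_cover_continuous cH).
have c1 : continuous (fun p : V => p.1.1).
  by move=> p; exact: cvg_comp cvg_fst cvg_fst.
have c2 : continuous (fun p : V => p.1.2).
  by move=> p; exact: cvg_comp cvg_fst cvg_snd.
have c3 : continuous (fun p : V => p.2.1).
  by move=> p; exact: cvg_comp cvg_snd cvg_fst.
have c4 : continuous (fun p : V => p.2.2).
  by move=> p; exact: cvg_comp cvg_snd cvg_snd.
(* Both [F \o k] and [F] lift [G], so [lift_unique] makes their difference an integer constant. *)
have deck (k : V -> V) : continuous k -> (forall p, G (k p) = G p) ->
    exists n : int, forall p, F (k p) = F p + n%:~R.
  move=> ck kG; apply: lift_unique => // [p|p]; last by rewrite !FG.
  by apply: continuous_comp; [exact: ck|exact: cF].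
have per u : circle_pi (u + 1 : R) = circle_pi u.
  by apply/circle_pi_eq; exists 1.
have [a Fa] : exists n : int, forall p : V,
    F ((p.1.1 + 1, p.1.2), (p.2.1, p.2.2)) = F p + n%:~R.
  apply: deck => [p|p]; last by rewrite /G /torus_pi /= per.
  have c1' : p.1.1 + 1 @[p --> p] --> p.1.1 + 1.
    by apply: cvgD; [exact: c1|exact: cvg_cst].
  have := cvg_pair (cvg_pair c1' (c2 p)) (cvg_pair (c3 p) (c4 p)).
  exact.
have [b Fb] : exists n : int, forall p : V,
    F ((p.1.1, p.1.2 + 1), (p.2.1, p.2.2)) = F p + n%:~R.
  apply: deck => [p|p]; last by rewrite /G /torus_pi /= per.
  have c2' : p.1.2 + 1 @[p --> p] --> p.1.2 + 1.
    by apply: cvgD; [exact: c2|exact: cvg_cst].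
  exact: (cvg_pair (cvg_pair (c1 p) c2') (cvg_pair (c3 p) (c4 p))).
have [c Fc] : exists n : int, forall p : V,
    F ((p.1.1 + alpha, p.1.1 + p.1.2), (p.2.1 - 1, p.2.2)) = F p + n%:~R.
  apply: deck => [p|[[x y] [t s]]]; last by rewrite /G /= -suspension_skew.
  have c1' : p.1.1 + alpha @[p --> p] --> p.1.1 + alpha.
    by apply: cvgD; [exact: c1|exact: cvg_cst].
  have c2' : p.1.1 + p.1.2 @[p --> p] --> p.1.1 + p.1.2.
    by apply: cvgD; [exact: c1|exact: c2].
  have c3' : p.2.1 - 1 @[p --> p] --> p.2.1 - 1.
    by apply: cvgB; [exact: c3|exact: cvg_cst].
  exact: (cvg_pair (cvg_pair c1' c2') (cvg_pair c3' (c4 p))).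
(* Two routes lead from the origin to [((alpha + 1, 1), (-1, 0))]. Shifting [x] and then applying
   the skew map adds a + c; applying the skew map and then shifting [y] and [x] adds c + b + a. *)
have b0 : b%:~R = 0 :> R.
  have E1 := Fc ((1, 0), (0, 0)); have E2 := Fa ((0, 0), (0, 0)).
  have E3 := Fa ((alpha, 1), (-1, 0)); have E4 := Fb ((alpha, 0), (-1, 0)).
  have E5 := Fc ((0, 0), (0, 0)).
  rewrite /= !(addr0, add0r) in E1 E2 E3 E4 E5.
  rewrite (addrC 1) E3 E4 E5 E2 in E1; lra.
pose r := a%:~R * alpha - c%:~R.
exists a, c; rewrite -/r.
(* Under the three deck transformations [K] changes by a - a, by b = 0, and by c - a alpha + r,
   which is 0 by the choice of [r]. *)
pose K (p : V) := F p - a%:~R * p.1.1 - r * p.2.1.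
have [M KM] : exists M, forall x y t s, 0 <= t -> 0 <= s <= 1 ->
    `|K ((x, y), (t, s))| <= M.
  apply: skew_bounded => [p|x y t s|x y t s|x y t s].
  - by apply: cvgB; [apply: cvgB; first exact: cF|]; apply: cvgM;
      [exact: cvg_cst|exact: c1|exact: cvg_cst|exact: c3].
  - by rewrite /K /= (Fa ((x, y), (t, s))) /=; ring.
  - by rewrite /K /= (Fb ((x, y), (t, s))) /= b0; ring.
  - by rewrite /K /= (Fc ((x, y), (t, s))) /= /r; ring.
(* Every slice of the homotopy has the same slope; the slices [s = 0] and [s = 1] are [f] and
   [g]. *)
suff sl (s : R) x : 0 <= s <= 1 -> asymptotic_slope (fun x => H (x, s)) x r.
  move=> x; split.
    have -> : f = (fun x => H (x, 0)) by exact/funext.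
    by apply: sl; rewrite lexx ler01.
  have -> : g = (fun x => H (x, 1)) by exact/funext.
  by apply: sl; rewrite lexx ler01.
move=> s01; have [{}x [y [t0 ->]]] := suspension_skew_surj x.
exists (fun t => F ((x, y), (t0 + t, s))); split.
- move=> t; have ct : t0 + u @[u --> t] --> t0 + t.
    by apply: cvgD; [exact: cvg_cst|exact: cvg_id].
  have cp : ((x, y), (t0 + u, s)) @[u --> t] --> (((x, y), (t0 + t, s)) : V).
    exact: (cvg_pair (cvg_cst (x, y)) (cvg_pair ct (cvg_cst s))).
  exact: cvg_comp cp (cF _).
- by move=> t; rewrite FG /G /= clamp01_id// suspension_flowE.
(* From time [- t0] on, the time coordinate [t0 + t] is nonnegative, so [KM] applies; the extra
   constant is the part of [F - K] independent of [t]. *)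
apply: (cvg_slope (C := M + `|a%:~R * x + r * t0|) (t0 := - t0)) => t tt0.
have := KM x y (t0 + t) s; rewrite -lerBlDl sub0r => /(_ tt0 s01) Kt.
have -> : F ((x, y), (t0 + t, s)) - r * t =
    K ((x, y), (t0 + t, s)) + (a%:~R * x + r * t0) by rewrite /K /=; ring.
by apply: le_trans (ler_normD _ _) _; rewrite lerD2r.
Qed.

(** The value [r] belongs to the set under [get], by homotopy invariance, so [get] returns an
    element of that set and not a default. That element is a slope of [phi] at some point, hence
    equals [r]. *)
Lemma schwartzman_slope {mu : probability (borel (torus R)) R}
    {phi : continuousType (suspension R T) (circle R)} {r : R} :
  (forall x, asymptotic_slope phi x r) -> schwartzman mu (Csharp_pi phi) = r.
Proof.
move=> phir; rewrite /schwartzman; set S := [set _ | _].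
have Sr : S r.
  move=> phi' /Csharp_piP/homotopic_slope[a [c ac]]; apply: aeW => x.
  have [phi'x phix] := ac x.
  by rewrite (asymptotic_slope_unique (phir x) phix).
(* The whole suspension has measure 1, so a property true almost everywhere holds at some point. *)
have ae_proper : ProperFilter (almost_everywhere (suspension_measure T mu)).
  apply: ae_properfilter_algebraOfSetsType.
  by have := @lte01 R; rewrite -(probability_setT (suspension_measure T mu)).
have [|x slx] := @filter_ex _ _ ae_proper
  (fun x => asymptotic_slope phi x (get S)).
  exact: (getPex (ex_intro _ r Sr) phi erefl).
exact: asymptotic_slope_unique slx (phir x).
Qed.

(** * Realizing every n + m alpha as a slope *)

Lemma skew_iter1 (k : int) (w : torus R) :
  (homeo_iter T k w).1 = w.1 + circle_pi (k%:~R * alpha).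
Proof.
case: k => k; elim: k => [|k IH] /=.
- by rewrite mul0r circle_pi0 addr0.
- have -> : k.+1%:~R * alpha = k%:~R * alpha + alpha
    by rewrite -addn1 PoszD intrD mulrDl mul1r.
  by rewrite circle_piD addrA -IH.
- have -> : (Negz 0)%:~R * alpha = - alpha by rewrite NegzE intrN mulNr mul1r.
  by rewrite -[- alpha]sub0r circle_piB circle_pi0 sub0r.
- have -> : (Negz k.+1)%:~R * alpha = (Negz k)%:~R * alpha - alpha.
    by rewrite !NegzE !intrN -[k.+2]addn1 PoszD intrD; ring.
  by rewrite circle_piB addrA -IH.
Qed.

(** Multiplication by [m] on R/Z, factored through representatives so that its continuity comes from
    the quotient topology. *)
Definition circle_mulz (m : int) : circle R -> circle R :=
  (fun x : R => circle_pi (m%:~R * x)) \o repr.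

Lemma circle_mulz_pi m x : circle_mulz m (circle_pi x) = circle_pi (m%:~R * x).
Proof.
rewrite /circle_mulz /=.
have /circle_pi_eq[k ->] := circle_piK (circle_pi x).
by apply/circle_pi_eq; exists (m * k); rewrite mulrDr intrM.
Qed.

Lemma circle_mulz_continuous m : continuous (circle_mulz m).
Proof.
apply: repr_comp_continuous => [x|x y /eqP /circle_pi_eq[k ->]].
  apply: (continuous_comp (f := fun x : R => m%:~R * x));
    last exact: circle_pi_continuous.
  by apply: cvgM; [exact: cvg_cst|exact: cvg_id].
by apply/eqP/circle_pi_eq; exists (m * k); rewrite mulrDr intrM.
Qed.

Lemma skew_slope_realize (n m : int) :
  exists phi : continuousType (suspension R T) (circle R),
    forall x, asymptotic_slope phi x (n%:~R + m%:~R * alpha).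
Proof.
pose r := n%:~R + m%:~R * alpha.
(* The sum m w.1 + r t is written as a difference so that [cvg_circleB] and [circle_piB] apply. *)
pose g (p : torus R * R) := circle_mulz m p.1.1 - circle_pi (- (r * p.2)).
have gE x y t : g (torus_pi (x, y), t) = circle_pi (m%:~R * x + r * t).
  by rewrite /g /= circle_mulz_pi -circle_piB opprK.
have g_inv (w w' : torus R) t t' :
    suspension_pi T w t = suspension_pi T w' t' -> g (w, t) = g (w', t').
  move=> /suspension_pi_eq[k [-> ->]]; rewrite /g /= skew_iter1.
  rewrite -(circle_piK w.1) -circle_piD !circle_mulz_pi -!circle_piB.
  (* Applying the [k]-th iterate adds m k alpha to the first term and takes k (n + m alpha) from the
     second: a net loss of the integer k n. *)
  by apply/circle_pi_eq; exists (k * n); rewrite intrM /r; ring.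
have cg : continuous g.
  move=> p; have c11 : (fun p : torus R * R => p.1.1) @ p --> p.1.1.
    exact: cvg_comp cvg_fst cvg_fst.
  have c1 := cvg_comp _ _ c11 (@circle_mulz_continuous m p.1.1).
  have crt : (fun p : torus R * R => - (r * p.2)) @ p --> - (r * p.2).
    by apply: cvgN; apply: cvgM; [exact: cvg_cst|exact: cvg_snd].
  have c2 := cvg_comp _ _ crt (@circle_pi_continuous R (- (r * p.2))).
  exact: (@cvg_circleB R (torus R * R)%type (fun p => circle_mulz m p.1.1)
    (fun p => circle_pi (- (r * p.2))) p c1 c2).
have cphi : continuous (g \o repr : suspension R T -> circle R).
  apply: repr_comp_continuous => // -[w t] [w' t'] /eqP E.
  by apply/eqP/g_inv.
exists (mkcts cphi) => p; have [x [y [t0 ->]]] := suspension_skew_surj p.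
exists (fun t => m%:~R * x + r * (t0 + t)); split.
- move=> t; apply: cvgD; first exact: cvg_cst.
  apply: cvgM; first exact: cvg_cst.
  by apply: cvgD; [exact: cvg_cst|exact: cvg_id].
- move=> t; rewrite suspension_flowE -(gE x y); apply: g_inv.
  by rewrite /= /suspension_pi -surjective_pairing; exact/esym/reprK.
apply: (cvg_slope (C := `|m%:~R * x + r * t0|) (t0 := 0)) => t _.
by rewrite mulrDr addrA addrK.
Qed.

End SkewSlope.

Theorem theorem8p5 (R : realType) (alpha : R) (halpha : irrational alpha) :
  schwartzman_range (skew_shift (circle_pi alpha)) (torus_lebesgue R) =
  [set r : R | exists n m : int, r = n%:~R + m%:~R * alpha].
Proof.
apply/seteqP; split => [_ [c _ <-]|_ [n [m ->]]].
  have [phi <-] : exists phi, Csharp_pi phi = c.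
    by exists (repr c); exact: reprK.
  (* The constant homotopy of [phi] yields the slope a alpha - b, whence the coefficients [- b] and
     [a]. *)
  have [a [b ab]] := homotopic_slope (homotopic_refl (@cts_fun _ _ phi)).
  rewrite (schwartzman_slope (fun x => (ab x).1)).
  by exists (- b), a; rewrite intrN addrC.
have [phi phir] := @skew_slope_realize R alpha n m.
by exists (Csharp_pi phi) => //; exact: schwartzman_slope.
Qed.
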